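(* Let $i\geq1$ and let $\tau$ be an SSRCT of shape $\alpha$ such that $\widetilde\alpha$ has an addable node in column $i$. Then $\mu_i(\tau)$ is an SSRCT of shape $\gamma/\!\!/(1)$, where $\gamma=u_i(\alpha)$.
   Context: Compositions (positive parts) are drawn as reverse composition diagrams: row $r$ from the top has $\alpha_r$ left-justified boxes; $\widetilde\alpha$ is the sorted partition. For the skew shape $\gamma/\!\!/(1)$ the single inner box is the first box of the last row. An SSRCT of shape $\gamma/\!\!/\beta$ (inner shape $\beta$ occupying, left-justified, the last $l(\beta)$ rows) is a filling of the non-inner boxes with positive integers such that rows weakly decrease left to right, the filled first-column entries strictly increase top to bottom, and for rows $r<s$ and column $c$ with $(s,c+1)$ a filled box: if $(r,c)$ is inner or $\tau(r,c)\geq\tau(s,c+1)$, then $(r,c+1)$ is inner or a filled box with $\tau(r,c+1)>\tau(s,c+1)$. Operators: $\mathfrak{d}_j(\alpha)$ subtracts $1$ from the rightmost part equal to $j$ (omitting a resulting $0$); $\mathfrak{v}_{[i-1]}=\mathfrak{d}_1\cdots\mathfrak{d}_{i-1}$ ($\mathfrak{d}_{i-1}$ first; $\mathfrak{v}_{[0]}=\mathrm{id}$); $a_i$ appends a part $i$; $u_i=a_i\mathfrak{v}_{[i-1]}$. $\phi_{j+1}$ ($j\geq1$), for an SSRCT $\tau$ of straight shape with a part equal to $j$ ($\tau=0$ outside the shape): $r_1$ is the largest row index of a part equal to $j$; for $t\geq2$, $r_t$ is the largest $r<r_{t-1}$ with $\tau(r,j)>\tau(r_{t-1},j)\geq\tau(r,j+1)$,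 ending at $r_k$; $\phi_{j+1}(\tau)$ places, for $t=k,\ldots,2$, the original $\tau(r_{t-1},j)$ into box $(r_t,j)$ and deletes box $(r_1,j)$ (and its row if empty); $\tau(r_k,j)$ exits. $\mu_i(\tau)$: if $i=1$ let $\tau'=\tau$, $H=\varnothing$; if $i\geq2$ let $\tau'=\phi_2(\cdots\phi_i(\tau)\cdots)$ and $H$ the multiset of the $i-1$ exiting entries. If $\tau'$ has shape $(\gamma_1,\ldots,\gamma_s)$, $\mu_i(\tau)$ is the filling of $(\gamma_1,\ldots,\gamma_s,i)/\!\!/(1)$ whose first $s$ rows are $\tau'$ and whose last row has an empty first box followed by the elements of $H$ in decreasing order. *)

(* Defs.v *)
From mathcomp Require Import all_boot.
Set Implicit Arguments. Unset Strict Implicit. Unset Printing Implicit Defensive.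

(* A composition is a list of positive parts; row r (1-indexed, from the top)
   of the reverse composition diagram has the r-th part many boxes. *)
Definition composition (a : seq nat) : bool := all (fun x => 0 < x) a.

Definition sorted_part (a : seq nat) : seq nat := sort geq a.

(* The partition lam has an addable node in column i: there is a row r
   (0-indexed here) with lam_r = i - 1 such that adding box (r, i) gives a
   partition, i.e. r is the top row or the row above has length >= i.  *)
Definition addable_col (lam : seq nat) (i : nat) : Prop :=
  exists r : nat, nth 0 lam r = i.-1 /\ (r = 0 \/ i <= nth 0 lam r.-1).

(* A filling: list of rows (top to bottom), each a list of entries (left to
   right).  Entries at inner boxes are irrelevant (we use 0 there). *)
Definition filling := seq (seq nat).

(* entry at (row r, column c), both 1-indexed; 0 outside the diagram. *)
Definition ent (T : filling) (r c : nat) : nat :=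
  if (r == 0) || (c == 0) then 0 else nth 0 (nth [::] T r.-1) c.-1.

Definition is_box (T : filling) (r c : nat) : bool :=
  [&& 0 < r, r <= size T, 0 < c & c <= size (nth [::] T r.-1)].

(* inner box of the skew shape gamma // beta, gamma = shape of T:
   beta occupies, left-justified, the last (size beta) rows. *)
Definition is_inner (T : filling) (beta : seq nat) (r c : nat) : bool :=
  [&& size T - size beta < r, r <= size T, 0 < c &
      c <= nth 0 beta (r - (size T - size beta)).-1].

Definition is_filled (T : filling) (beta : seq nat) (r c : nat) : bool :=
  is_box T r c && ~~ is_inner T beta r c.

Definition is_SSRCT (T : filling) (gamma beta : seq nat) : Prop :=
  [/\ composition gamma, composition beta,
      map size T = gamma &
      size beta <= size gamma] /\
  [/\
      (forall k, k < size beta ->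
          nth 0 beta k <= nth 0 gamma (size gamma - size beta + k)),
      (forall r c, is_filled T beta r c -> 0 < ent T r c) &
      (forall r c, is_filled T beta r c -> is_filled T beta r c.+1 ->
          ent T r c.+1 <= ent T r c)] /\
  (
      (forall r s, r < s -> is_filled T beta r 1 -> is_filled T beta s 1 ->
          ent T r 1 < ent T s 1) /\
      (forall r s c, 0 < r -> r < s -> 0 < c -> is_filled T beta s c.+1 ->
          (is_inner T beta r c || (is_filled T beta r c && (ent T s c.+1 <= ent T r c))) ->
          (is_inner T beta r c.+1 ||
             (is_filled T beta r c.+1 && (ent T s c.+1 < ent T r c.+1))))).

(* d_j : subtract 1 from the rightmost part equal to j (omit a resulting 0).
   (Identity if there is no part equal to j; never used in that case.) *)
Definition dop (j : nat) (a : seq nat) : seq nat :=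
  if j \in a then
    let k := size a - (index j (rev a)).+1 in
    if j == 1 then take k a ++ drop k.+1 a else set_nth 0 a k j.-1
  else a.

Fixpoint vop (n : nat) (a : seq nat) : seq nat :=
  match n with 0 => a | n'.+1 => vop n' (dop n'.+1 a) end.

Definition aop (i : nat) (a : seq nat) : seq nat := rcons a i.

Definition uop (i : nat) (a : seq nat) : seq nat := aop i (vop i.-1 a).

Fixpoint find_last (P : nat -> bool) (n : nat) : option nat :=
  match n with
  | 0 => None
  | n'.+1 => if (n' != 0) && P n' then Some n' else find_last P n'
  end.

Fixpoint chain_from (T : filling) (j fuel prev : nat) : seq nat :=
  match fuel with
  | 0 => [::]
  | f.+1 =>
    match find_last (fun r => (ent T prev j < ent T r j) &&
                              (ent T r j.+1 <= ent T prev j)) prev with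
    | None => [::]
    | Some r => r :: chain_from T j f r
    end
  end.

Definition set_ent (T : filling) (r c v : nat) : filling :=
  set_nth [::] T r.-1 (set_nth 0 (nth [::] T r.-1) c.-1 v).

Definition del_box (T : filling) (r j : nat) : filling :=
  if j == 1 then take r.-1 T ++ drop r T
  else set_nth [::] T r.-1 (take j.-1 (nth [::] T r.-1)).

(* phi_{j+1}(T) for j >= 1: returns the new filling and the exiting entry.
   (Identity if T has no row of length j; never used in that case.) *)
Definition phi (j : nat) (T : filling) : filling * nat :=
  match find_last (fun r => size (nth [::] T r.-1) == j) (size T).+1 with
  | None => (T, 0)
  | Some r1 =>
    let rs := r1 :: chain_from T j r1 r1 in
    let moved := foldl (fun U p => set_ent U p.2 j (ent T p.1 j)) T
                       (zip rs (behead rs)) in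
    (del_box moved r1 j, ent T (last r1 rs) j)
  end.

Fixpoint iter_phi (n : nat) (T : filling) : filling * seq nat :=
  match n with
  | 0 => (T, [::])
  | n'.+1 =>
    let (T1, x) := phi n'.+1 T in
    let (T2, H) := iter_phi n' T1 in (T2, x :: H)
  end.

(* mu_i(T): rows of tau', then a last row whose first box is the inner box
   (stored as 0) followed by the exiting entries in decreasing order. *)
Definition mu (i : nat) (T : filling) : filling :=
  let (T', H) := iter_phi i.-1 T in rcons T' (0 :: sort geq H).

(* Main.v *)
(* Read phi_{j+1} as a shift along a chain that starts in a virtual row r_0 below
   the diagram holding the value v_0 = 0: row r_t receives v_{t-1}, and r_1 is
   just the first step of the same greedy search.  A row s off the chain with
   entry above the current value v_u has, by maximality of r_{u+1}, a right
   neighbour z > v_u; the triple condition against s then keeps all later chain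
   values below z.  This yields the triple condition after the shift, and shows
   that the exiting entry x_j satisfies it against columns j, j+1, i.e. in the
   new last row.  Comparing two successive chains gives x_{j-1} >= x_j, so x_j
   is the entry placed in column j+1 of the last row. *)

Require Import Defs.
From mathcomp Require Import all_boot zify.
Set Implicit Arguments. Unset Strict Implicit. Unset Printing Implicit Defensive.

(** * Greedy chains in two adjacent columns *)

(* [a] and [b] are two adjacent columns; [greedy N v rs] says that [rs] is the
   chain of rows found upwards from row [N] (excluded) holding the value [v]. *)
Section Chains.
Variables a b : nat -> nat.

Fixpoint greedy (N v : nat) (rs : seq nat) : Prop :=
  match rs with
  | [::] => forall r, 0 < r < N -> v < a r -> v < b r
  | q :: rs' =>
    [/\ 0 < q < N, b q <= v < a q,
        forall r, q < r < N -> v < a r -> v < b r & greedy q (a q) rs']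
  end.

Fixpoint shift (v : nat) (rs : seq nat) (r : nat) : nat :=
  match rs with
  | [::] => a r
  | q :: rs' => if r == q then v else shift (a q) rs' r
  end.

Definition exit (v : nat) (rs : seq nat) : nat := last v (map a rs).

Lemma greedy_bound N v rs q : greedy N v rs -> q \in rs -> 0 < q < N.
Proof.
elim: rs N v => // p rs IH N v [hp _ _ g]; rewrite in_cons.
by case/orP=> [/eqP -> //|/(IH _ _ g)]; lia.
Qed.

Lemma greedy_uniq N v rs : greedy N v rs -> uniq rs.
Proof.
elim: rs N v => // p rs IH N v [hp _ _ g] /=; rewrite (IH _ _ g) andbT.
by apply/negP => /(greedy_bound g); lia.
Qed.

Lemma shiftE v rs r : r \notin rs -> shift v rs r = a r.
Proof.
elim: rs v => //= q rs IH v; rewrite in_cons negb_or => /andP[/negPf -> h].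
exact: IH.
Qed.

Lemma leq_exit N v rs : greedy N v rs -> v <= exit v rs.
Proof.
elim: rs N v => //= q rs IH N v [_ h _ /IH]; rewrite /exit /=; lia.
Qed.

Lemma leq_exit_mem N v rs q : greedy N v rs -> q \in rs -> a q <= exit v rs.
Proof.
elim: rs N v => //= p rs IH N v [_ h _ g]; rewrite in_cons /exit /=.
by case/orP=> [/eqP ->|]; [apply: leq_exit g | apply: IH g].
Qed.

Lemma shift_bounds N v rs r :
  greedy N v rs -> r \in rs -> [/\ v <= shift v rs r, b r <= shift v rs r & shift v rs r < a r].
Proof.
elim: rs N v => //= q rs IH N v [_ h _ g]; rewrite in_cons.
case: eqP => [-> _|_ /= hr]; first by split; lia.
by case: (IH _ _ g hr) => *; split; lia.
Qed.

Lemma shift_leq N v rs r : greedy N v rs -> shift v rs r <= a r.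
Proof.
move=> g; have [hr|hr] := boolP (r \in rs); last by rewrite shiftE.
by case: (shift_bounds g hr); lia.
Qed.

Lemma shift_mono N v rs r s :
  greedy N v rs -> r \in rs -> s \in rs -> r < s -> shift v rs s < shift v rs r.
Proof.
elim: rs N v => //= q rs IH N v [_ h _ g]; rewrite !in_cons.
case: (r =P q) => [-> _|_ /= hr].
  by case: eqP => [->|_ /= /(greedy_bound g)]; lia.
case: (s =P q) => [-> _ _|_ /= hs]; last exact: IH g _ _.
by case: (shift_bounds g hr); lia.
Qed.

Lemma shift_mem N v rs s :
  greedy N v rs -> s \in rs ->
  shift v rs s = v \/ exists2 s', s < s' & shift v rs s = a s'.
Proof.
elim: rs N v => //= q rs IH N v [_ h _ g]; rewrite in_cons.
case: eqP => [-> _|_ /= hs]; first by left.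
right; case: (IH _ _ g hs) => // ->.
by exists q => //; case/andP: (greedy_bound g hs).
Qed.

Hypothesis ba : forall r, b r <= a r.
Hypothesis triple_ab : forall r s, r < s -> 0 < b s <= a r -> b s < b r.
Hypothesis a_inj : forall r s, 0 < a r -> a r = a s -> r = s.

(* Each chain row q has b q bounded by the preceding chain value, so the triple
   condition for (q, s) forces the next chain value below b s as well. *)
Lemma greedy_lt_b N v rs s :
  greedy N v rs -> {in rs, forall q, q < s} -> v < b s ->
  exit v rs < b s.
Proof.
elim: rs N v => //= q rs IH N v [_ h _ g] lts vs; rewrite /exit /=.
apply: IH g _ _ => [p hp|]; first by apply: lts; rewrite in_cons hp orbT.
have qs : q < s by apply: lts; rewrite mem_head.
by rewrite ltnNge; apply/negP => le; have := triple_ab qs; lia.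
Qed.

(** The search passes over [r] at some current value below [a r]. Maximality puts that value below
    [b r], and [greedy_lt_b] carries the bound on to the exit. *)
Lemma exit_triple N v rs r :
  greedy N v rs -> 0 < r < N -> r \notin rs -> exit v rs < a r ->
  exit v rs < b r.
Proof.
elim: rs N v => [|q rs IH] N v; first by move=> /= g hr _ /(g _ hr).
move=> gg; have [hq h mx g] := gg; rewrite in_cons negb_or => hr /andP[rq hrs] lt.
have [rltq|] := ltnP r q; first by apply: (IH q) => //; lia.
rewrite leq_eqVlt eq_sym (negPf rq) /= => qr.
have := leq_exit gg => vx.
apply: greedy_lt_b gg _ _ => [p|]; last by apply: mx; lia.
by rewrite in_cons => /orP[/eqP -> //|/(greedy_bound g)]; lia.
Qed.

(** Let [v] be the current value when the search passes [s]. If [a s < v], all later chain rows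
    receive at least [v]. Otherwise [v < a s], and maximality with [greedy_lt_b] would put every
    later chain value below [a s], against [a s < a r]. *)
Lemma shift_gt N v rs r s :
  greedy N v rs -> s < N -> s \notin rs -> 0 < a s -> a s <> v ->
  r \in rs -> r < s -> a s < a r -> a s < shift v rs r.
Proof.
elim: rs N v => [//|q rs IH] N v gg sN; have [hq h mx g] := gg.
rewrite in_cons negb_or => /andP[sq hs] as0 asv hr rs_ lt.
have [sltq|] := ltnP s q.
  move: hr; rewrite in_cons /=; case: eqP => [|_ /= hr]; first by lia.
  by apply: (IH q) => // e; case/eqP: sq; apply: a_inj.
rewrite leq_eqVlt eq_sym (negPf sq) /= => qs.
have [ltv|lev] := ltnP (a s) v.
  by have [le _ _] := shift_bounds gg hr; apply: leq_trans le.
have bs : v < b s by apply: mx; lia.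
suff: exit v (q :: rs) < b s.
  by have := leq_exit_mem gg hr; have := ba s; lia.
apply: greedy_lt_b gg _ bs => p.
by rewrite in_cons => /orP[/eqP -> //|/(greedy_bound g)]; lia.
Qed.

Variable p : nat -> nat.
Hypothesis triple_pa : forall r s, r < s -> 0 < a s <= p r -> a s < a r.

(** Here [p] is the column left of [a]. If only [s] is on the chain, its new value comes from a row
    [s'] below, and the old condition for [r] and [s'] applies. If [s] is off the chain, the old
    condition gives [a s < a r], and [shift_gt] preserves it. *)
Lemma triple_shift N rs r s :
  greedy N 0 rs -> s < N -> r < s -> 0 < shift 0 rs s <= p r ->
  shift 0 rs s < shift 0 rs r.
Proof.
move=> g sN rs_; have [hs|hs] := boolP (s \in rs).
  have [hr|hr] := boolP (r \in rs); first by move=> _; apply: shift_mono g _ _ _.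
  rewrite (shiftE _ hr); case: (shift_mem g hs) => [-> //|[s' ss' ->]].
  by apply: triple_pa; lia.
rewrite (shiftE _ hs) => h; have lt := triple_pa rs_ h.
have [hr|hr] := boolP (r \in rs); last by rewrite (shiftE _ hr).
by apply: (shift_gt g) => //; lia.
Qed.

(** Descent from the exit: an [x] below the chain value [a q] is below [p q], hence below the value
    that [q] receives, which is the previous chain value. *)
Lemma lt_start_of_shift N v rs x :
  greedy N v rs -> (forall r, a r <= p r) ->
  {in rs, forall q, x < p q -> x < shift v rs q} -> x < exit v rs -> x < v.
Proof.
move=> + ap; elim: rs N v => //= q rs IH N v [hq hv _ g] h lt.
have lq : x < a q.
  apply: (IH _ _ g _ lt) => r hr xr.
  have := h r; rewrite in_cons hr orbT => /(_ isT xr).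
  by case: eqP => // rq; have := greedy_bound g hr; lia.
by have := h q (mem_head _ _); rewrite eqxx; apply; have := ap q; lia.
Qed.

End Chains.

(** * Tableau conditions and their preservation under a shift *)

(** Entries are meant to be 0 off the diagram, so positivity stands for being a box. *)
Definition is_tableau (f : nat -> nat -> nat) : Prop :=
  [/\ forall r c, 0 < c -> f r c.+1 <= f r c,
      forall r s, r < s -> 0 < f r 1 -> 0 < f s 1 -> f r 1 < f s 1 &
      forall r s c, 0 < c -> r < s -> 0 < f s c.+1 <= f r c ->
        f s c.+1 < f r c.+1].

(** The start value 0 encodes the deletion: the first chain row receives 0 in column [j]. *)
Definition shift_col (f : nat -> nat -> nat) j rs r c :=
  if c == j then shift (f^~ j) 0 rs r else f r c.

Section Tableau.
Variables (f : nat -> nat -> nat) (tab : is_tableau f).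

(** Beyond column 1, equal entries in two rows satisfy the premise of the triple condition because
    rows weakly decrease, and its strict conclusion is absurd. *)
Lemma col_inj c r s : 0 < c -> 0 < f r c -> f r c = f s c -> r = s.
Proof.
case: tab => row col tri.
suff lt u t : 0 < c -> 0 < f u c -> f u c = f t c -> ~ u < t.
  move=> c0 r0 e; have := lt _ _ c0 r0 e; have := lt s r c0; rewrite -e.
  by move=> /(_ r0 erefl); lia.
case: c => // -[|c] _ u0 e ut; first by have := col _ _ ut u0; lia.
by have := tri u t c.+1 isT ut; have := row u c.+1 isT; lia.
Qed.

Variables (j N : nat) (rs : seq nat).
Hypotheses (j0 : 0 < j) (g : greedy (f^~ j) (f^~ j.+1) N 0 rs).
Hypothesis fN : forall r c, 0 < f r c -> 0 < r < N.

Lemma is_tableau_shift : is_tableau (shift_col f j rs).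
Proof.
have [row col tri] := tab.
have le r : shift (f^~ j) 0 rs r <= f r j by apply: shift_leq g.
have bj r : f r j.+1 <= f r j by apply: row.
have trij r s : r < s -> 0 < f s j.+1 <= f r j -> f s j.+1 < f r j.+1.
  exact: tri.
have injj r s : 0 < f r j -> f r j = f s j -> r = s by apply: col_inj.
split=> [r c c0|r s rs_|r s c c0 rs_]; rewrite /shift_col.
- case: (c.+1 =P j) => [e|_].
    have -> : (c == j) = false by apply/eqP; lia.
    by apply: leq_trans (le r) _; rewrite -e; apply: row.
  case: eqP => [->|_]; last exact: row.
  have [hr|hr] := boolP (r \in rs); last by rewrite shiftE.
  by case: (shift_bounds g hr).
- case: eqP => [e|_]; last exact: col.
  (* A chain in column 1 has at most one row: chain values grow upwards, while the column grows
     downwards. *)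
  have rs1 : forall q, q \in rs -> q = head 0 rs.
    case: rs g => [//|q [|q' t]] /=; first by move=> _ x; rewrite inE => /eqP.
    by case=> hq hv _ [hq' hv' _ _]; have := col q' q; rewrite e; lia.
  have le0 q : q \in rs -> shift (f^~ j) 0 rs q = 0.
    move=> hq; have := rs1 _ hq; case: rs hq => //= x t _ ->.
    by rewrite eqxx.
  have [hr|hr] := boolP (r \in rs); first by rewrite le0.
  have [hs|hs] := boolP (s \in rs); first by rewrite (le0 s).
  by rewrite !shiftE // -e; apply: col.
- case: (c.+1 =P j) => [e|_].
    have -> : (c == j) = false by apply/eqP; lia.
    move=> h; apply: (triple_shift (p := f^~ c) bj trij injj _ g _ rs_ h) => [u t ut|].
      by rewrite -e; exact: tri.
    by have := le s; have := fN (r := s) (c := j); lia.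
  (* When the shifted column is the left one of the triple, its entries only drop, so the premise
     held before the shift. *)
  case: eqP => [->|_] h; last exact: tri.
  by apply: trij => //; have := le r; lia.
Qed.

(** The triple condition for [x] placed in column [j.+1] of a row below all others. On the chain the
    premise fails, since the new entry is below the old one, which is at most [x]. Off the chain,
    distinctness of column entries makes the premise strict and [exit_triple] applies. *)
Lemma shift_col_exit r (x := exit (f^~ j) 0 rs) :
  0 < x -> x <= shift_col f j rs r j -> x < shift_col f j rs r j.+1.
Proof.
have [row _ tri] := tab.
rewrite /shift_col eqxx ifN; last by lia.
move=> x0; have [hr|hr] := boolP (r \in rs).
  case: (shift_bounds g hr) => _ _ lt; have := leq_exit_mem g hr; rewrite -/x /=.
  by move: lt => /=; lia.
rewrite shiftE // => le.
have lt : x < f r j.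
  rewrite ltn_neqAle le andbT; apply/eqP => e.
  have : x \in 0 :: map (f^~ j) rs by apply: mem_last.
  rewrite in_cons => /orP[|/mapP[q hq eq]]; first by lia.
  have rq : r = q by apply: (@col_inj j) => //; lia.
  by rewrite rq hq in hr.
apply: (exit_triple _ g) => //; last by apply: (fN (c := j)); lia.
by move=> u s; apply: tri.
Qed.

End Tableau.

(** Serves the case where deleting a box in column 1 removes its row: [h] then gives the old index
    of each remaining row. *)
Lemma is_tableau_reindex f h g :
  (forall r s, r < s -> h r < h s) -> is_tableau f ->
  (forall r c, g r c = f (h r) c) -> is_tableau g.
Proof.
move=> hh [row col tri] e; split=> *; rewrite !e.
- exact: row.
- by apply: col; rewrite -?e //; apply: hh.
- by apply: tri; rewrite -?e //; apply: hh.
Qed.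

(** * Comparison of two successive exits *)

(** Suppose the second exit is smaller. A row [q] of the first chain whose entry in column [j]
    exceeds it is off the second chain, so [shift_col_exit] puts the second exit below the value
    that [q] received. Then [lt_start_of_shift] descends to the start value 0. *)
Lemma exit_le f f' j N rs M rs' :
  is_tableau f -> 0 < j ->
  greedy (f^~ j.+1) (f^~ j.+2) N 0 rs ->
  (forall r c, 0 < f r c -> 0 < r < N) ->
  (forall r c, f' r c = shift_col f j.+1 rs r c) ->
  greedy (f'^~ j) (f'^~ j.+1) M 0 rs' ->
  (forall r c, 0 < f' r c -> 0 < r < M) ->
  0 < exit (f'^~ j) 0 rs' ->
  exit (f^~ j.+1) 0 rs <= exit (f'^~ j) 0 rs'.
Proof.
move=> tab j0 g fN ef g' fM x0; have [row _ _] := tab.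
have tab' : is_tableau f'.
  by apply: (is_tableau_reindex (h := id)) ef => //; apply: is_tableau_shift g _.
rewrite leqNgt; apply/negP => lt.
suff: exit (f'^~ j) 0 rs' < 0 by [].
apply: (lt_start_of_shift (p := f^~ j) g) lt => [r|q hq lt]; first exact: row.
have e r : f' r j = f r j by rewrite ef /shift_col ifN //; lia.
have nq : q \notin rs'.
  by apply/negP => /(leq_exit_mem g') /=; rewrite e; move: lt => /=; lia.
have := shift_col_exit tab' j0 g' fM (r := q) x0.
rewrite {1}/shift_col eqxx shiftE // e => /(_ (ltnW lt)).
by rewrite /shift_col ifN; last lia; rewrite ef /shift_col eqxx.
Qed.

(** * From list operations to chains and shifts *)

Lemma find_lastP P n :
  match find_last P n with
  | Some r => [/\ 0 < r < n, P r & forall s, r < s < n -> ~~ P s]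
  | None => forall s, 0 < s < n -> ~~ P s
  end.
Proof.
elim: n => [|n IH] /=; first by move=> s; lia.
case: ifP => [/andP[n0 Pn]|nP]; first by split=> // [|s]; lia.
have last s : s = n -> 0 < s -> ~~ P s.
  by move=> -> n0; move: nP; rewrite -lt0n n0 => /= ->.
case: (find_last P n) IH => [r [hr Pr mx]|mx]; first split=> //; first by lia.
  by move=> s hs; have [/last->|] := eqVneq s n => //; [lia | move=> ?; apply: mx; lia].
by move=> s hs; have [/last->|] := eqVneq s n => //; [lia | move=> ?; apply: mx; lia].
Qed.

(** Chain rows strictly decrease, so a fuel of at least [prev] never cuts the search short. *)
Lemma chain_from_greedy T j fuel prev :
  prev <= fuel ->
  greedy (ent T ^~ j) (ent T ^~ j.+1) prev (ent T prev j)
    (chain_from T j fuel prev).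
Proof.
elim: fuel prev => [|n IH] prev le /=; first by move=> r; lia.
move: (find_lastP (fun r => (ent T prev j < ent T r j) &&
  (ent T r j.+1 <= ent T prev j)) prev).
case: find_last => [r [hr Pr mx]|mx] /=.
  split=> //; first by lia.
    by move=> s hs lt; have := mx _ hs; rewrite lt /= -ltnNge.
  by apply: IH; lia.
by move=> s hs lt; have := mx _ hs; rewrite lt /= -ltnNge.
Qed.

Lemma map_set_nth (A B : Type) (f : A -> B) d s n y :
  map f (set_nth d s n y) = set_nth (f d) (map f s) n (f y).
Proof.
by elim: s n => [|x s IH] [|n] //=; rewrite ?IH //; elim: n => //= n [->].
Qed.

Lemma set_nth_nth (A : Type) (d : A) s k : k < size s -> set_nth d s k (nth d s k) = s.
Proof. by elim: s k => // x s IH [|k] //= /IH ->. Qed.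

Lemma is_boxE T r c :
  is_box T r c =
  [&& 0 < r, r <= size (map size T), 0 < c & c <= nth 0 (map size T) r.-1].
Proof.
rewrite /is_box size_map; case: r => //= r; case: ltnP => // h.
by rewrite (nth_map [::]).
Qed.

Lemma ent_is_box T r c : 0 < ent T r c -> is_box T r c.
Proof.
rewrite /ent /is_box; case: r => // r; case: c => // c /=.
move=> h; apply/andP; split.
  by rewrite ltnNge; apply/negP => le; rewrite (nth_default [::] le) nth_nil in h.
by rewrite ltnNge; apply/negP => le; rewrite (nth_default 0 le) in h.
Qed.

Lemma ent_set_ent U r c v r' c' : 0 < r -> 0 < c ->
  ent (set_ent U r c v) r' c' =
  if (r' == r) && (c' == c) then v else ent U r' c'.
Proof.
case: r c r' c' => // r [//|c] [|r'] [|c'] _ _ //=; first by rewrite andbF.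
rewrite /ent /set_ent /= !eqSS nth_set_nth /=; case: eqP => //= ->.
by rewrite nth_set_nth.
Qed.

Lemma map_size_set_ent U r c v :
  is_box U r c -> map size (set_ent U r c v) = map size U.
Proof.
move=> /and4P[r0 rU c0 cU]; rewrite map_set_nth size_set_nth.
rewrite (maxn_idPr _); last by lia.
rewrite -(nth_map [::] 0); last by lia.
by rewrite set_nth_nth // size_map; lia.
Qed.

(** Values are read from the original [T] and the rows are distinct, so the order of the writes does
    not matter. *)
Lemma ent_foldl_set_ent T j U q rs r c :
  0 < j -> uniq rs -> {in rs, forall s, 0 < s} ->
  ent (foldl (fun U p => set_ent U p.2 j (ent T p.1 j)) U (zip (q :: rs) rs)) r c =
  if (c == j) && (r \in rs) then shift (ent T ^~ j) (ent T q j) rs r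
  else ent U r c.
Proof.
move=> j0; elim: rs q U => [|s rs IH] q U; first by rewrite andbF.
case/andP=> sn u pos.
have -> : zip (q :: s :: rs) (s :: rs) = (q, s) :: zip (s :: rs) rs by [].
rewrite [foldl _ _ _]/= IH // => [|x hx]; last by apply: pos; rewrite in_cons hx orbT.
rewrite ent_set_ent ?(pos _ (mem_head s rs)) // in_cons /=.
by case: (c =P j) => _ /=; case: (r =P s) => //= ->; rewrite (negPf sn).
Qed.

Lemma map_size_foldl_set_ent T j U q rs :
  {in rs, forall s, is_box U s j} ->
  map size (foldl (fun U p => set_ent U p.2 j (ent T p.1 j)) U (zip (q :: rs) rs))
  = map size U.
Proof.
elim: rs q U => [//|s rs IH] q U h.
have hs : is_box U s j by apply: h; apply: mem_head.
have -> : zip (q :: s :: rs) (s :: rs) = (q, s) :: zip (s :: rs) rs by [].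
rewrite [foldl _ _ _]/= IH ?map_size_set_ent // => x hx.
by rewrite is_boxE map_size_set_ent // -is_boxE h // in_cons hx orbT.
Qed.

Lemma dopE j a k :
  k < size a -> nth 0 a k = j -> (forall l, k < l < size a -> nth 0 a l <> j) ->
  dop j a = if j == 1 then take k a ++ drop k.+1 a else set_nth 0 a k j.-1.
Proof.
move=> ka kj mx; rewrite /dop -{1}kj mem_nth //.
suff -> : size a - (index j (rev a)).+1 = k by [].
have e : a = take k a ++ j :: drop k.+1 a by rewrite -kj -drop_nth // cat_take_drop.
have -> : index j (rev a) = size (drop k.+1 a).
  rewrite {1}e rev_cat rev_cons cat_rcons index_cat mem_rev ifN.
    by rewrite /= eqxx addn0 size_rev.
  apply/negP => /(nthP 0)[l]; rewrite size_drop nth_drop => hl.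
  by apply: mx; have {}hl : l < size a - k.+1 := hl; lia.
by rewrite size_drop; lia.
Qed.

(** Guarantees that the next operator of [vop] finds its part. *)
Lemma mem_dop j a : 1 < j -> j \in a -> j.-1 \in dop j a.
Proof.
move=> j1 ja; rewrite /dop ja; have -> : (j == 1) = false by lia.
set k := (X in set_nth _ _ X); apply/(nthP 0); exists k; last by rewrite nth_set_nth /= eqxx.
by rewrite size_set_nth; lia.
Qed.

Lemma composition_dop j a : composition a -> composition (dop j a).
Proof.
rewrite /composition /dop => ca; case: ifP => // ja.
have j0 : 0 < j by apply: (allP ca).
case: eqP => [_|j1].
  rewrite all_cat; apply/andP; split; apply/allP => x hx; apply: (allP ca).
    exact: mem_take hx.
  exact: mem_drop hx.
have k : size a - (index j (rev a)).+1 < size a.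
  by have : 0 < size a; [case: (a) ja | lia].
apply/(all_nthP 0) => l; rewrite size_set_nth nth_set_nth /= => hl.
by case: eqP => _; [lia | apply: (all_nthP 0 ca); lia].
Qed.

Definition all_pos (T : filling) : Prop := forall r c, is_box T r c -> 0 < ent T r c.

Lemma all_pos_is_box T r c : all_pos T -> is_box T r c = (0 < ent T r c).
Proof. by move=> pT; apply/idP/idP; [apply: pT | apply: ent_is_box]. Qed.

(** In terms of columns [j] and [j.+1] this is the greedy test [b r <= 0 < a r] for the value 0. *)
Lemma size_row_ent T r j :
  all_pos T -> 0 < j -> 0 < r < (size T).+1 ->
  (size (nth [::] T r.-1) == j) = (0 < ent T r j) && (ent T r j.+1 == 0).
Proof.
move=> pT j0 hr; rewrite -all_pos_is_box // -[_ == 0]negbK -lt0n -all_pos_is_box //.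
by rewrite /is_box; lia.
Qed.

Lemma is_box_row T r c c' : is_box T r c -> 0 < c' <= c -> is_box T r c'.
Proof. by rewrite /is_box; lia. Qed.

Lemma ent_del_box_row T r j c s :
  1 < j -> 0 < r -> size (nth [::] T r.-1) = j ->
  ent (del_box T r j) s c = if (c == j) && (s == r) then 0 else ent T s c.
Proof.
case: r => // r j1 _; rewrite /= => sj.
have -> : del_box T r.+1 j = set_nth [::] T r (take j.-1 (nth [::] T r)).
  by rewrite /del_box ifN //; lia.
case: s c => [|s] [|c]; rewrite ?andbF /ent ?eqSS //=.
  by case: ifP.
rewrite nth_set_nth /=; case: (s =P r) => [->|_]; last by rewrite andbF.
rewrite andbT; case: eqP => [e|ne].
  by rewrite nth_default // size_take sj; case: ifP; lia.
case: (ltnP c j.-1) => h; first by rewrite nth_take.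
by rewrite [LHS]nth_default ?[RHS]nth_default ?size_take_min ?sj //; lia.
Qed.

Lemma nth_del_row (A : Type) (d : A) s r l :
  0 < r -> r <= size s -> 0 < l ->
  nth d (take r.-1 s ++ drop r s) l.-1 = nth d s (bump r l).-1.
Proof.
move=> r0 rs l0; rewrite nth_cat size_take.
have -> : r.-1 < size s by lia.
rewrite /bump; case: ltnP => h.
  by rewrite nth_take //; have -> : (r <= l) = false by lia.
by rewrite nth_drop; congr (nth _ _ _); lia.
Qed.

(** Reads [phi] as a shift. The map [h] differs from the identity only for [j = 1], where it skips
    the deleted row. *)
Lemma phiP T j (T' := (phi j T).1) :
  is_tableau (ent T) -> all_pos T -> 0 < j -> j \in map size T ->
  exists rs h,
    [/\ greedy (ent T ^~ j) (ent T ^~ j.+1) (size T).+1 0 rs,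
        (phi j T).2 = exit (ent T ^~ j) 0 rs,
        0 < (phi j T).2 &
        [/\ forall r s, r < s -> h r < h s,
            1 < j -> h = id,
            forall r c, ent T' r c = shift_col (ent T) j rs (h r) c,
            all_pos T' &
            map size T' = dop j (map size T)]].
Proof.
move=> tab pT j0 jT; rewrite {}/T' /phi.
move: (find_lastP (fun r => size (nth [::] T r.-1) == j) (size T).+1).
case: find_last => [r1 [hr1 sr1 mx]|none]; last first.
  case/(nthP 0): jT => l; rewrite size_map => hl; rewrite (nth_map [::]) // => e.
  by have := none l.+1; rewrite /= e eqxx => /(_ hl).
set rs := chain_from T j r1 r1.
(* The chain starts in the row just below the diagram; a row under [r1] with an entry in column [j]
   has length other than [j], hence a right neighbour. *)
have g : greedy (ent T ^~ j) (ent T ^~ j.+1) (size T).+1 0 (r1 :: rs).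
  have := sr1; rewrite size_row_ent // => /andP[a1 b1].
  split=> //; first by lia.
    move=> r hr ar; rewrite lt0n; apply: contraNN (mx _ hr) => b0.
    by rewrite size_row_ent ?ar ?b0 //; lia.
  exact: chain_from_greedy.
have /= u := greedy_uniq g; case/andP: u => r1n u.
have bnd q : q \in rs -> 0 < q < r1.
  by have [_ _ _ g'] := g; apply: greedy_bound g'.
have box q : q \in rs -> is_box T q j.
  move=> hq; apply: ent_is_box.
  have hq' : q \in r1 :: rs by rewrite in_cons hq orbT.
  by case: (shift_bounds g hq') => /= _ _; lia.
have dE : dop j (map size T) = if j == 1
    then take r1.-1 (map size T) ++ drop r1 (map size T)
    else set_nth 0 (map size T) r1.-1 j.-1.
  have [r10 _] := andP hr1; rewrite -{2}(prednK r10); apply: dopE.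
  - by rewrite size_map; lia.
  - by rewrite (nth_map [::]); [apply/eqP | lia].
  move=> l; rewrite size_map => hl; rewrite (nth_map [::]); last by lia.
  by apply/eqP; apply: (mx l.+1); lia.
exists (r1 :: rs), (if j == 1 then bump r1 else id).
have ex : ent T (last r1 (r1 :: rs)) j = exit (ent T ^~ j) 0 (r1 :: rs).
  by rewrite /exit /= (last_map (ent T ^~ j)).
split; rewrite // ?[(_, _).2]/=.
  by rewrite ex; have := leq_exit_mem g (mem_head _ _); case: g => _ /=; lia.
set U := foldl _ T _.
have eU r c : ent U r c = if (c == j) && (r \in rs)
    then shift (ent T ^~ j) (ent T r1 j) rs r else ent T r c.
  by rewrite ent_foldl_set_ent // => s /bnd/andP[].
have sU : map size U = map size T by apply: map_size_foldl_set_ent.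
have szU : size U = size T by rewrite -(size_map size) sU size_map.
have [e1|j1] := j =P 1.
  have rs0 : rs = [::].
    case: (rs) g => // q t [_ hv1 _ [hq hv _ _]]; exfalso.
    have [_ col _] := tab; have := col q r1; rewrite -e1.
    by move: hv hv1 => /=; lia.
  have UT : U = T by rewrite /U rs0.
  rewrite UT rs0 /del_box e1 /=.
  have eB r c : ent (take r1.-1 T ++ drop r1 T) r c = ent T (bump r1 r) c.
    rewrite /ent; case: r => [|r]; first by rewrite /bump; case: (r1) hr1.
    have -> : (bump r1 r.+1 == 0) = false by rewrite /bump; lia.
    by rewrite nth_del_row //; lia.
  split=> // [r s|r c|r c|]; last by rewrite -e1 dE e1 /= map_cat map_take map_drop.
  - by rewrite /bump; lia.
  - rewrite eB /shift_col /=; case: eqP => // ->.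
    by rewrite ifN // eq_sym neq_bump.
  rewrite eB => b; apply: pT; move: b.
  case: r => [|r]; first by rewrite /is_box.
  rewrite /is_box nth_del_row //; try lia.
  by rewrite size_cat size_take size_drop /bump; case: ifP; lia.
have j1' : 1 < j by lia.
have sr1U : size (nth [::] U r1.-1) = j.
  rewrite -(nth_map [::] 0 size); last by lia.
  by rewrite sU (nth_map [::]); [apply/eqP | lia].
have eD r c : ent (del_box U r1 j) r c = shift_col (ent T) j (r1 :: rs) r c.
  rewrite ent_del_box_row //; last by lia.
  rewrite eU /shift_col /=; case: (c =P j) => //= ->.
  by case: eqP => //= _; case: ifP => // nr; rewrite shiftE ?nr.
have sD : map size (del_box U r1 j) = dop j (map size T).
  rewrite dE /del_box; have -> : (j == 1) = false by lia.
  by rewrite map_set_nth sU size_take sr1U; case: ifP => //; lia.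
split=> // r c; rewrite is_boxE sD dE.
have -> : (j == 1) = false by lia.
rewrite size_set_nth nth_set_nth size_map /= eD => b.
have bT : is_box T r c.
  rewrite is_boxE size_map; have [e|ne] := eqVneq r r1.
    by rewrite e eqxx in b; rewrite e (nth_map [::]) ?(eqP sr1); lia.
  by move: b; case: eqP => [|_] *; lia.
rewrite /shift_col; case: (c =P j) => [e|_]; last exact: pT.
have nr : r <> r1 by move=> e'; rewrite e' eqxx in b; lia.
rewrite /= (introF eqP nr) -e; have [hr|hr] := boolP (r \in rs).
  (* Chain rows above [r1] receive at least the positive entry of [r1]. *)
  have [_ hv _ g'] := g; case: (shift_bounds g' hr); rewrite e; move: hv => /=; lia.
by rewrite shiftE // pT.
Qed.

Lemma phi_tableau T j :
  is_tableau (ent T) -> all_pos T -> 0 < j -> j \in map size T ->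
  is_tableau (ent (phi j T).1).
Proof.
move=> tab pT j0 jT; have [rs [h [g _ _ [hm _ eT _ _]]]] := phiP tab pT j0 jT.
apply: is_tableau_reindex hm _ eT; apply: is_tableau_shift g _ => // r c.
by move/ent_is_box/and4P => [-> ]; lia.
Qed.

(** * Iterating the shifts and collecting the exits *)

(** The clause on [n < c] lets the triple condition of an exit survive the later shifts, which
    change columns further right only by omitting a row. Exits are listed from the rightmost column
    on, so position [c] of [rev H] holds the exit of column [c.+1]. *)
Lemma iter_phiP n T :
  is_tableau (ent T) -> all_pos T -> composition (map size T) ->
  (0 < n -> n \in map size T) ->
  let T' := (iter_phi n T).1 in let H := (iter_phi n T).2 in
  exists h,
    [/\ is_tableau (ent T'), all_pos T', composition (map size T'),
        map size T' = vop n (map size T) &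
    [/\ size H = n, sorted leq H, all (leq 1) H,
        forall r c, n < c -> ent T' r c = ent T (h r) c &
        forall r c, c < n -> nth 0 (rev H) c <= ent T' r c.+1 ->
          nth 0 (rev H) c < ent T' r c.+2]].
Proof.
have ent_bound U r c : 0 < ent U r c -> 0 < r < (size U).+1.
  by move/ent_is_box/and4P => [-> ]; lia.
elim: n T => [|n IH] T tab pT cT nT; first by exists id.
have {}nT := nT isT; have tab1 := phi_tableau tab pT (ltn0Sn n) nT.
have [rs [h [g ex x0 [hm hid eT pT1 sT1]]]] := phiP tab pT (ltn0Sn n) nT.
have exT r := shift_col_exit tab (ltn0Sn n) g (@ent_bound T) (r := h r).
rewrite /= -ex in exT; move: exT => /(_ _ x0) exT.
have nT1 : 0 < n -> n \in map size (phi n.+1 T).1.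
  by move=> n0; rewrite sT1; apply: (mem_dop (j := n.+1)).
have xle : 0 < n -> (phi n.+1 T).2 <= (phi n (phi n.+1 T).1).2.
  move=> n0; have [rs' [h' [g' ex' x0' _]]] := phiP tab1 pT1 n0 (nT1 n0).
  rewrite ex ex'; apply: (exit_le tab n0 g (@ent_bound T)) g' (@ent_bound _) _.
    by move=> r c; rewrite eT hid.
  by rewrite -ex'.
have cT1 : composition (map size (phi n.+1 T).1) by rewrite sT1 composition_dop.
move: IH => /(_ _ tab1 pT1 cT1 nT1).
have hd : 0 < n -> head 0 (iter_phi n (phi n.+1 T).1).2 = (phi n (phi n.+1 T).1).2.
  by case: (n) => //= m _; case: (phi m.+1 _) => ? ?; case: (iter_phi m _).
move: hd xle eT exT x0 sT1; rewrite /=; case: (phi n.+1 T) => T1 x /=.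
case: (iter_phi n T1) => T2 H /= hd xle eT exT x0 sT1.
move=> [h2 [tab2 pT2 cT2 sT2 [sH soH aH e2 ex2]]].
exists (h \o h2); split=> //; first by rewrite sT2 sT1.
split=> //=.
- by rewrite sH.
- case: H hd soH sH {aH ex2} => //= y H hd -> sH; rewrite andbT.
  by rewrite hd ?xle //; lia.
- by rewrite x0.
- by move=> r c nc; rewrite e2 ?eT /shift_col ?ifN //; lia.
move=> r c; rewrite rev_cons nth_rcons size_rev sH => hc.
case: ltnP => [|hn]; first exact: ex2.
have -> : c = n by lia.
by rewrite eqxx !e2 ?eT //; apply: exT.
Qed.

(** * Between SSRCTs and tableau conditions; the new last row *)

Lemma is_filled_nil T r c : is_filled T [::] r c = is_box T r c.
Proof. by rewrite /is_filled /is_inner /=; lia. Qed.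

Lemma is_SSRCT_tableau T a :
  is_SSRCT T a [::] ->
  [/\ is_tableau (ent T), all_pos T, composition (map size T) & map size T = a].
Proof.
case=> [[ca _ sT _] [[_ pos row] [col tri]]].
have pT : all_pos T by move=> r c; rewrite -is_filled_nil; apply: pos.
have fE r c : is_filled T [::] r c = (0 < ent T r c).
  by rewrite is_filled_nil all_pos_is_box.
split=> //; last by rewrite sT.
split=> [r c c0|r s rs r0 s0|r s c c0 rs /andP[s0 le]].
- case: (posnP (ent T r c.+1)) => [-> //|h]; apply: row; rewrite fE //.
  by rewrite -all_pos_is_box //; apply: is_box_row (ent_is_box h) _; lia.
- by apply: col; rewrite ?fE.
have r0 : 0 < r.
  by case: r rs le => //; rewrite {2}/ent /=; lia.
have := tri r s c r0 rs c0; rewrite !fE => /(_ s0).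
have inner x : is_inner T [::] r x = false.
  by rewrite /is_inner /=; lia.
by rewrite !inner le /= andbT => /(_ _)/andP[|//]; lia.
Qed.

Section LastRow.
Variables (T : filling) (G : seq nat).
Let M := rcons T (0 :: G).

Lemma ent_rcons r c :
  ent M r c = if r == (size T).+1 then ent [:: 0 :: G] 1 c else ent T r c.
Proof.
rewrite /ent; case: r => // r; case: c => [|c] /=; first by case: ifP.
rewrite nth_rcons eqSS; case: ltngtP => // h.
by rewrite [nth [::] T r]nth_default ?nth_nil //; lia.
Qed.

Lemma is_inner_rcons r c : is_inner M [:: 1] r c = (r == (size T).+1) && (c == 1).
Proof.
rewrite /is_inner size_rcons subSS subn0; case: (r =P (size T).+1) => [->|ne].
  by rewrite subSnn /=; lia.
by rewrite /=; lia.
Qed.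

Lemma is_filled_rcons r c :
  all_pos T -> all (leq 1) G -> is_filled M [:: 1] r c = (0 < ent M r c).
Proof.
move=> pT pG; rewrite /is_filled is_inner_rcons ent_rcons.
have [->|ne] /= := eqVneq r (size T).+1.
  rewrite /is_box size_rcons /= nth_rcons ltnn eqxx /= /ent /=.
  case: c => [|[|c]]; rewrite ?leqnn ?andbF //= andbT ltnS.
  case: ltnP => [h|h]; last by rewrite nth_default.
  by rewrite (all_nthP 0 pG).
rewrite andbT -all_pos_is_box // /is_box size_rcons nth_rcons.
case: r ne => //= r; rewrite eqSS ltnS => ne.
by rewrite leq_eqVlt (negPf ne) /=; case: ltnP.
Qed.

(** The only new triples have the new row as lower row, and the last hypothesis covers them: column
    [c.+2] of that row holds entry [c] of [G]. Its first box is inner, so it is exempt from the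
    first-column condition. *)
Lemma is_SSRCT_rcons :
  is_tableau (ent T) -> all_pos T -> composition (map size T) ->
  sorted geq G -> all (leq 1) G ->
  (forall r c, c < size G -> nth 0 G c <= ent T r c.+1 ->
     nth 0 G c < ent T r c.+2) ->
  is_SSRCT M (rcons (map size T) (size G).+1) [:: 1].
Proof.
move=> tab pT cT sG pG ex; have [row col tri] := tab.
have fE r c := is_filled_rcons r c pT pG.
have G0 c : ent [:: 0 :: G] 1 c.+2 = nth 0 G c by [].
split; first split=> //.
- by rewrite /composition all_rcons.
- by rewrite map_rcons.
- by rewrite size_rcons.
split; first split=> [k|r c|r c].
- rewrite ltnS leqn0 => /eqP -> /=.
  by rewrite size_rcons subSS subn0 addn0 nth_rcons ltnn eqxx.
- by rewrite fE.
- rewrite !fE !ent_rcons; case: eqP => [_|ne].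
    case: c => [|[|c]] //; rewrite !G0 => c0 c1.
    have hc : c.+1 < size G.
      by rewrite ltnNge; apply/negP => h; rewrite nth_default in c1.
    have tr : transitive geq by move=> x y z /= ? ?; lia.
    by apply: (sorted_leq_nth tr leqnn 0 sG) => //; rewrite inE; lia.
  by case: c => [|c]; [rewrite /ent orbT | move=> *; apply: row].
split=> [r s rs|r s c r0 rs c0]; rewrite !fE !ent_rcons.
  case: eqP => // r1; case: eqP => // s1; exact: col.
rewrite !is_inner_rcons; case: (s =P _) => [es|ns].
  have -> : (r == (size T).+1) = false by lia.
  case: c c0 => // c _; rewrite G0 /= => h /andP[_ le].
  have hc : c < size G.
    by rewrite ltnNge; apply/negP => h'; rewrite nth_default in h.
  by have := ex r c hc le; lia.
move=> s0; have := ent_is_box s0; rewrite /is_box => hs.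
have -> : (r == (size T).+1) = false by lia.
rewrite /= => /andP[_ le]; have := tri r s c c0 rs; lia.
Qed.

End LastRow.

(** A positive [n] cannot be the default 0 that [nth] returns past the end, so it is an actual
    part. *)
Lemma addable_mem a n : addable_col (sorted_part a) n.+1 -> 0 < n -> n \in a.
Proof.
case=> r [/= e _] n0; rewrite -(mem_sort geq) -e mem_nth // ltnNge.
by apply/negP => le; rewrite (nth_default 0 le) in e; lia.
Qed.

Theorem theorem6p24 (i : nat) (alpha : seq nat) (tau : filling) :
  1 <= i ->
  is_SSRCT tau alpha [::] ->
  addable_col (sorted_part alpha) i ->
  is_SSRCT (mu i tau) (uop i alpha) [:: 1].
Proof.
case: i => // n _ /is_SSRCT_tableau[tab pT cT <-] add.
have [h] := iter_phiP tab pT cT (addable_mem add).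
rewrite /mu /uop /aop /=; case: iter_phi => T H /= [tab' pT' cT' <-].
move=> [sH soH pH _ ex].
(* The exits are already weakly increasing, so sorting them decreasingly is reversal. *)
have -> : sort geq H = rev H.
  have srt : sorted geq (rev H) by rewrite rev_sorted.
  rewrite -(sorted_sort _ srt); last by move=> x y z /= ? ?; lia.
  apply/perm_sortP; rewrite 1?perm_sym ?perm_rev //.
  - by move=> x y /=; lia.
  - by move=> x y z /= ? ?; lia.
  - by move=> x y /=; lia.
rewrite -sH -(size_rev H); apply: is_SSRCT_rcons => //.
- by rewrite rev_sorted.
- by rewrite all_rev.
by rewrite size_rev sH.
Qed.
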